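(* For every $k\in\mathbb{Z}_{>0}$ there exists an element $\theta_k\in\mathbb{C}[\mathfrak{S}_{k+1}]$, independent of $n$, such that for every $n\ge k+2$ $$I^{[n]}_k=\sum_{m=0}^{n-1}\gamma_n^{m}\,\pi_{k+1}(\theta_k)\,\gamma_n^{-m}.$$ For example, one can take $\theta_1=\sigma_{1,2}$, $\theta_2=(\sigma_{2,3}\,\sigma_{1,2}-\sigma_{1,2}\,\sigma_{2,3}-1)/2$.
   Context: $\mathfrak{S}_n$ is the symmetric group; $\sigma_{a,b}$ is the transposition of $a$ and $b$; permutations are multiplied as functions (right factor acts first). $\pi_{k}:\mathbb{C}[\mathfrak{S}_k]\to\mathbb{C}[\mathfrak{S}_n]$, $k\le n$, is the embedding induced by $i\mapsto i$. Set $G^{[n]}_k=\sum_{1\le i_1<\dots<i_k\le n}\sigma_{i_1,i_2}\sigma_{i_2,i_3}\cdots\sigma_{i_{k-1},i_k}$ for $k=2,\dots,n$; these elements pairwise commute. Put $S^{[n]}_1(u)=n\,u^{n-1}+\sum_{k=2}^nG^{[n]}_k\,u^{n-k}$ and $\gamma_n=\sigma_{1,2}\sigma_{2,3}\cdots\sigma_{n-1,n}=G^{[n]}_n$. Then for $n\ge2$ $$\gamma_n^{-1}S^{[n]}_1(u)=1+\sum_{k=1}^{n-2}\gamma_n^{-1}G^{[n]}_{n-k}u^k+\gamma_n^{-1}n\,u^{n-1},$$ and the elements $I^{[n]}_k\in\mathbb{C}[\mathfrak{S}_n]$ are defined by the formal power series identity $\log\bigl(\gamma_n^{-1}S^{[n]}_1(u)\bigr)=\sum_{k=1}^\infty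 I^{[n]}_k\,u^k$. *)

(* Defs.v *)
From HB Require Import structures.
From mathcomp Require Import all_boot all_fingroup all_algebra.

Set Implicit Arguments.
Unset Strict Implicit.
Unset Printing Implicit Defensive.

Import GRing.Theory.
Local Open Scope ring_scope.

(* Product of permutations as functions, right factor first; the MathComp     *)
(* group law on 'S_n is the opposite one (its left factor acts first).        *)
Definition perm_comp n (s t : 'S_n) : 'S_n := (t * s)%g.

Lemma perm_compE n (s t : 'S_n) i : perm_comp s t i = s (t i).
Proof. by rewrite permM. Qed.

(* The group algebra F[S_n] for the product perm_comp. *)
Definition galg (F : fieldType) (n : nat) := {ffun 'S_n -> F^o}.

HB.instance Definition _ (F : fieldType) n :=
  GRing.Lmodule.copy (galg F n) {ffun 'S_n -> F^o}.

Definition ge (F : fieldType) n (s : 'S_n) : galg F n :=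
  [ffun t => (t == s)%:R].

(* The transposition sigma_{a,b} of F[S_(k+1)] with the points labelled       *)
(* 1, ..., k+1; the point with label a is the ordinal a - 1.                  *)
Definition sigma (F : fieldType) k (a b : nat) : galg F k.+1 :=
  ge F (tperm (inord a.-1) (inord b.-1)).

Section GroupAlgebra.
Variables (F : fieldType) (n : nat).
Implicit Types f g h : galg F n.

Definition galg_mul f g : galg F n :=
  [ffun s => \sum_(a : 'S_n) (f a : F) * g (perm_comp a^-1%g s)].

Fact galg_mulA : associative galg_mul.
Proof.
move=> f g h; apply/ffunP=> s; rewrite !ffunE.
under eq_bigr => a _ do rewrite ffunE mulr_sumr.
under [RHS]eq_bigr => b _ do rewrite ffunE mulr_suml.
rewrite [RHS]exchange_big /=; apply: eq_bigr => a _.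
rewrite [RHS](reindex_inj (mulIg a)) /=; apply: eq_bigr => b _.
by rewrite /perm_comp mulgK invMg mulgA mulrA.
Qed.

Fact galg_mul1r : left_id (ge F (1%g : 'S_n)) galg_mul.
Proof.
move=> f; apply/ffunP=> s; rewrite ffunE (bigD1 (1%g : 'S_n)) //= big1.
  by rewrite ffunE eqxx mul1r addr0 /perm_comp invg1 mulg1.
by move=> a /negPf a1; rewrite ffunE a1 mul0r.
Qed.

Fact galg_mulr1 : right_id (ge F (1%g : 'S_n)) galg_mul.
Proof.
move=> f; apply/ffunP=> s; rewrite ffunE (bigD1 s) //= big1.
  by rewrite ffunE /perm_comp mulgV eqxx mulr1 addr0.
move=> a /negPf sa; rewrite ffunE /perm_comp -eq_mulgV1 eq_sym sa.
by rewrite mulr0.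
Qed.

Fact galg_mulDl : left_distributive galg_mul +%R.
Proof.
move=> f g h; apply/ffunP=> s; rewrite !ffunE -big_split /=.
by apply: eq_bigr => a _; rewrite ffunE mulrDl.
Qed.

Fact galg_mulDr : right_distributive galg_mul +%R.
Proof.
move=> f g h; apply/ffunP=> s; rewrite !ffunE -big_split /=.
by apply: eq_bigr => a _; rewrite ffunE mulrDr.
Qed.

Fact galg_oner_neq0 : ge F (1%g : 'S_n) != 0 :> galg F n.
Proof.
apply/eqP=> /ffunP/(_ 1%g); rewrite !ffunE eqxx => /eqP.
by rewrite (negPf (oner_neq0 F)).
Qed.

HB.instance Definition _ := GRing.Zmodule_isNzRing.Build (galg F n)
  galg_mulA galg_mul1r galg_mulr1 galg_mulDl galg_mulDr galg_oner_neq0.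

Fact galg_scalerAl (c : F) f g : c *: (f * g) = (c *: f) * g.
Proof.
apply/ffunP=> s; rewrite !ffunE scaler_sumr.
by apply: eq_bigr => a _; rewrite ffunE; apply: mulrA.
Qed.

HB.instance Definition _ :=
  GRing.Lmodule_isLalgebra.Build F (galg F n) galg_scalerAl.

Fact galg_scalerAr (c : F) f g : c *: (f * g) = f * (c *: g).
Proof.
apply/ffunP=> s; rewrite !ffunE scaler_sumr.
by apply: eq_bigr => a _; rewrite ffunE; apply: mulrCA.
Qed.

HB.instance Definition _ :=
  GRing.Lalgebra_isAlgebra.Build F (galg F n) galg_scalerAr.

Lemma ge1 : ge F (1%g : 'S_n) = 1.
Proof. by []. Qed.

Lemma geM (s t : 'S_n) : ge F (perm_comp s t) = ge F s * ge F t.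
Proof.
apply/ffunP=> x; rewrite !ffunE (bigD1 s) //= big1 => [|a /negPf sa].
  rewrite !ffunE eqxx mul1r addr0 /perm_comp.
  by rewrite -(inj_eq (mulIg s^-1%g)) mulgK.
by rewrite ffunE sa mul0r.
Qed.

End GroupAlgebra.

Section Embedding.
Variables (k n : nat) (lekn : (k <= n)%N).

Definition ext_fun (s : 'S_k) (i : 'I_n) : 'I_n :=
  if insub (i : nat) is Some j then widen_ord lekn (s j) else i.

Fact ext_fun_inj (s : 'S_k) : injective (ext_fun s).
Proof.
have extE (j : 'I_k) (i : 'I_n) : i = j :> nat -> ext_fun s i = s j :> nat.
  by move=> ij; rewrite /ext_fun ij valK.
have extN (i : 'I_n) : (k <= i)%N -> ext_fun s i = i.
  by move=> ki; rewrite /ext_fun insubN // -leqNgt.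
move=> i1 i2 E; apply: val_inj => /=.
have [l1|k1] := ltnP i1 k; have [l2|k2] := ltnP i2 k.
- have := congr1 val E.
  rewrite /= (extE (Ordinal l1) i1) // (extE (Ordinal l2) i2) // => /val_inj.
  by move=> /perm_inj [].
- have := congr1 val E; rewrite /= (extE (Ordinal l1) i1) // (extN _ k2) => Ev.
  by have := ltn_ord (s (Ordinal l1)); rewrite Ev ltnNge k2.
- have := congr1 val E; rewrite /= (extE (Ordinal l2) i2) // (extN _ k1) => Ev.
  by have := ltn_ord (s (Ordinal l2)); rewrite -Ev ltnNge k1.
- by move: E; rewrite !extN // => ->.
Qed.

(* The permutation acting as s on the first k points and fixing the others. *)
Definition ext_perm (s : 'S_k) : 'S_n := perm (@ext_fun_inj s).

Definition pi_embed (F : fieldType) (f : galg F k) : galg F n :=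
  \sum_(s : 'S_k) (f s : F) *: ge F (ext_perm s).

End Embedding.

(* sigma_{i1,i2} sigma_{i2,i3} ... sigma_{i(r-1),ir} for t = [:: i1; ...; ir] *)
Definition chain n (t : seq 'I_n) : 'S_n :=
  \big[@perm_comp n/1%g]_(p <- zip t (behead t)) tperm p.1 p.2.

Section Elements.
Variables (F : fieldType) (n : nat).

Definition G (k : nat) : galg F n :=
  \sum_(t : k.-tuple 'I_n | sorted ltn [seq val i | i <- t]) ge F (chain t).

Definition S1 : {poly galg F n} :=
  n%:R *: 'X^(n - 1) + \sum_(2 <= k < n.+1) G k *: 'X^(n - k).

Definition gamma : 'S_n := chain (enum 'I_n).

End Elements.

(* Coefficient of u^k in log p = \sum_(j >= 1) (-1)^(j-1) (p - 1)^j / j, for p *)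
(* with constant coefficient 1. The terms with j > k do not contribute, see   *)
(* log_coef_trunc.                                                            *)
Definition log_coef (F : fieldType) (A : algType F) (p : {poly A}) (k : nat) : A :=
  \sum_(1 <= j < k.+1) ((-1) ^+ (j - 1) / j%:R : F) *: ((p - 1) ^+ j)`_k.

Lemma log_coef_trunc (F : fieldType) (A : algType F) (p : {poly A}) (k N : nat) :
  p`_0 = 1 -> (k <= N)%N ->
  \sum_(1 <= j < N.+1) ((-1) ^+ (j - 1) / j%:R : F) *: ((p - 1) ^+ j)`_k
    = log_coef p k.
Proof.
move=> p0 kN; rewrite (@big_cat_nat _ _ _ k.+1) //=.
rewrite [X in _ + X]big_nat_cond [X in _ + X]big1 ?addr0 // => j.
rewrite andbT => /andP[kj _].
suff -> : p - 1 = drop_poly 1 (p - 1) * 'X.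
  by rewrite exprMn_comm; [rewrite coefMXn kj scaler0 | apply: commr_polyX].
apply/polyP=> -[|i]; rewrite coefMX /=; first by rewrite coefB p0 coef1 subrr.
by rewrite coef_drop_poly addn1.
Qed.

(* Only meant for n >= 2, where ge gamma^-1 *: S1 has constant coefficient 1. *)
Definition I_elt (F : fieldType) (n k : nat) : galg F n :=
  log_coef (ge F (gamma n)^-1%g *: S1 F n) k.

(* Here gamma^(-m) is the m-th power of the inverse of gamma. *)
Definition is_theta (F : fieldType) (k : nat) (theta : galg F k.+1) : Prop :=
  forall (n : nat) (hn : (k.+2 <= n)%N),
    I_elt F n k =
      \sum_(0 <= m < n)
        ge F (gamma n) ^+ m * pi_embed (ltnW hn) theta *
        ge F (gamma n)^-1%g ^+ m.

(* Main.v *)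
Require Import Defs.
From HB Require Import structures.
From mathcomp Require Import all_boot all_fingroup all_algebra reals complex.
From mathcomp Require Import zify.

Import GRing.Theory.
Local Open Scope ring_scope.

(** The elements I_k are local conserved densities: the theorem is a linked
    cluster expansion of a logarithm on a circle of n sites.

    Write c_A for the cycle through the points of A in increasing order, so that
    S_1(u) is the sum of u^(n - |A|) c_A over the nonempty sets A
    (run_poly_setT). Put K for the complement of A and see e in K as the edge
    {e - 1, e} of the circle Z/n. Then gamma^-1 c_A is a product of disjoint
    cycles, one for each run of consecutive edges of K (run_perm). Let P_M be the
    sum of u^|K| gamma^-1 c_(~K) over the subsets K of a set M of edges, and
    f(M) the coefficient of u^k in log P_M; hence f of the set of all edges is
    I_k. Four facts on f give the theorem.

    - Degree: each power of u brings at most one edge, so f(M) is the sum over the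
      subsets N of M of weights g(N) that vanish when |N| > k (deg_le_log_coef).
    - Additivity: if M misses two edges, these cut the circle into two arcs, P_M is
      the product of the two commuting polynomials attached to the parts of M in
      these arcs, and f(M) is the sum of the values of f on them (run_log_cut).
      This rests on log (p q) = log p + log q for commuting p and q
      (log_coefM), where the logarithm is seen as the derivative of p^m in m at
      m = 0. Consequently g(N) = 0 unless N is a run of at most k
      consecutive edges (weight_split).
    - Covariance: rotating M by one step conjugates P_M by gamma (run_poly_shift).
    - Linearity: if M misses the edge {n - 1, 0}, then P_M is the product
      of the factors 1 + u sigma_(e, e+1), e in M, taken in decreasing order
      (run_poly_prod), which does not depend on n.

    So I_k is the sum over m of the weights of the runs starting at m
    (sum_arcs), and these are the rotations of the weights of the runs starting at
    edge 1, whose sum is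
      theta_k = [u^k] log ((1 + u sigma_(k,k+1)) ... (1 + u sigma_(1,2)))
              - [u^k] log ((1 + u sigma_(k,k+1)) ... (1 + u sigma_(2,3))),
    an element of the group algebra of S_(k+1). For k = 1 and k = 2 it is the
    element given in the theorem. *)

Set Implicit Arguments.
Unset Strict Implicit.
Unset Printing Implicit Defensive.

(** * The logarithm of a product of commuting power series *)

Section BinomialPolynomials.
Variables (F : fieldType) (charF0 : [pchar F] =i pred0).

(** The binomial coefficient 'C(X, j) as a polynomial in its upper argument. *)
Definition binpoly (j : nat) : {poly F} :=
  \prod_(i < j) ((i.+1%:R)^-1 *: ('X - i%:R%:P)).

Let natF_neq0 i : i.+1%:R != 0 :> F.
Proof. by rewrite ((pcharf0P F).1 charF0). Qed.

Lemma binpoly_nat j m : (binpoly j).[m%:R] = 'C(m, j)%:R.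
Proof.
elim: j => [|j IHj]; first by rewrite /binpoly big_ord0 hornerC bin0.
rewrite /binpoly big_ord_recr /= -/(binpoly j) hornerM IHj hornerZ hornerXsubC mulrCA.
apply: (mulfI (natF_neq0 j)); rewrite mulVKf // -natrM mul_bin_left.
have [ltmj|lejm] := ltnP m j; first by rewrite bin_small // muln0 mul0r.
by rewrite natrM natrB // mulrC.
Qed.

Lemma size_binpoly j : (size (binpoly j) <= j.+1)%N.
Proof.
elim: j => [|j IHj]; first by rewrite /binpoly big_ord0 size_poly1.
rewrite /binpoly big_ord_recr /= -/(binpoly j).
apply: leq_trans (size_polyMleq _ _) _.
by rewrite size_scale ?invr_eq0 // size_XsubC addn2.
Qed.

Lemma binpoly_coef0 j : (binpoly j)`_0 = (j == 0)%:R.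
Proof. by rewrite -horner_coef0 -(mulr0n 1) binpoly_nat bin0n eq_sym; case: j. Qed.

(** The coefficients of the logarithmic series are the derivatives at 0 of the
    binomial polynomials; this is how (d/dm) (1 + x)^m at m = 0 becomes
    log (1 + x). *)
Lemma binpoly_coef1 j : (binpoly j.+1)`_1 = (-1) ^+ j / j.+1%:R.
Proof.
elim: j => [|j IHj]; rewrite /binpoly big_ord_recr /= -/(binpoly _).
  by rewrite /binpoly big_ord0 mul1r invr1 scale1r subr0 coefX mulr1.
rewrite -scalerAr coefZ mulrBr coefB coefMX coefMC IHj binpoly_coef0 sub0r.
by rewrite divfK // exprSr mulrN1 mulrC.
Qed.

(** Differentiation at 0 on polynomials of degree < d is a linear combination
    of the evaluations at 0, ..., d - 1, because the Vandermonde matrix of these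
    points is invertible in characteristic 0. *)
Lemma coef1_functional d : exists lam : 'I_d -> F,
  forall p : {poly F}, (size p <= d)%N -> p`_1 = \sum_(m < d) lam m * p.[m%:R].
Proof.
pose a := \row_(m < d) (m%:R : F).
have Vu : Vandermonde d a \in unitmx.
  rewrite unitmxE det_Vandermonde unitfE.
  apply/prodf_neq0 => i _; apply/prodf_neq0 => j ltij; rewrite !mxE subr_eq0.
  rewrite -subr_eq0 -natrB 1?ltnW // -(subnSK ltij); exact: natF_neq0.
pose e := \col_(i < d) ((i == 1%N :> nat)%:R : F).
pose l := invmx (Vandermonde d a) *m e.
exists (fun m => l m 0) => p sp; rewrite -[LHS](_ : \sum_(i < d) p`_i * e i 0 = _).
  have -> : e = Vandermonde d a *m l by rewrite mulKVmx.
  under eq_bigr do rewrite mxE mulr_sumr.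
  rewrite exchange_big /=; apply: eq_bigr => m _.
  rewrite (horner_coef_wide _ sp) mulr_sumr; apply: eq_bigr => i _.
  by rewrite !mxE mulrA mulrC.
have [d1|d1] := ltnP 1 d.
  rewrite (bigD1 (Ordinal d1)) //= mxE eqxx mulr1 big1 ?addr0 // => i ni.
  by rewrite mxE -val_eqE in ni *; rewrite (negPf ni) mulr0.
rewrite nth_default ?(leq_trans sp) // big1 // => i _; rewrite mxE.
by rewrite ltn_eqF ?mulr0 // (leq_trans (ltn_ord i)).
Qed.

End BinomialPolynomials.

Section LogAdditive.
Variables (F : fieldType) (charF0 : [pchar F] =i pred0) (A : algType F).
Implicit Types p q x y : {poly A}.

Lemma coefM_low p q i j k : (forall l, (l < i)%N -> p`_l = 0) ->
  (forall l, (l < j)%N -> q`_l = 0) -> (k < i + j)%N -> (p * q)`_k = 0.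
Proof.
move=> p0 q0 kij; rewrite coefM big1 // => l _.
have [li|il] := ltnP l i; first by rewrite p0 ?mul0r.
rewrite q0 ?mulr0 // ltn_subLR ?(leq_trans kij) ?leq_add2r //.
by rewrite -ltnS ltn_ord.
Qed.

Lemma coefX_low x i k : x`_0 = 0 -> (k < i)%N -> (x ^+ i)`_k = 0.
Proof.
move=> x0; elim: i k => // i IHi k ki; rewrite exprS.
apply: (coefM_low (i := 1) (j := i)) => //; by case.
Qed.

Lemma expr_sub1_wide p m d : (m < d)%N ->
  p ^+ m = \sum_(i < d) (p - 1) ^+ i *+ 'C(m, i).
Proof.
move=> md; rewrite -[p in LHS](subrK 1) exprD1n.
rewrite (big_ord_widen _ (fun i => (p - 1) ^+ i *+ 'C(m, i)) md) big_mkcond /=.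
by apply: eq_bigr => i _; case: ltnP => // mi; rewrite bin_small.
Qed.

(** The logarithm is the derivative of m |-> p^m at m = 0. For commuting p and q
    one has (p q)^m = p^m q^m, whose derivative at 0 is log p + log q, both
    factors being 1 at m = 0. The derivative is taken through the finite
    functional lam, so that only the powers m = 0, ..., k occur. *)
Lemma log_coefM p q k : p`_0 = 1 -> q`_0 = 1 -> p * q = q * p ->
  log_coef (p * q) k = log_coef p k + log_coef q k.
Proof.
have [lam lamE] := coef1_functional charF0 k.+1.
pose c i : F := (binpoly F i)`_1.
have cE (z : {poly A}) : log_coef z k = \sum_(i < k.+1) c i *: ((z - 1) ^+ i)`_k.
  rewrite -(big_mkord xpredT (fun i => c i *: ((z - 1) ^+ i)`_k)) big_ltn //.
  rewrite /c {1}/binpoly big_ord0 coef1 scale0r add0r.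
  by apply: eq_big_nat => -[|j] // _; rewrite subn1 binpoly_coef1.
(* Leibniz rule at 0 for the product of two binomial polynomials. *)
have cM i j : (i + j <= k)%N ->
    \sum_(m < k.+1) lam m * ('C(m, i) * 'C(m, j))%:R
      = (j == 0)%:R * c i + (i == 0)%:R * c j.
  move=> ijk; under eq_bigr do rewrite natrM -!(binpoly_nat charF0) -hornerM.
  rewrite -lamE.
    rewrite coefM !big_ord_recl big_ord0 /= !(binpoly_coef0 charF0) addr0.
    by rewrite addrC [c i * _]mulrC.
  apply: leq_trans (size_polyMleq _ _) _.
  have /leq_trans-> // :
      ((size (binpoly F i) + size (binpoly F j)).-1 <= (i.+1 + j.+1).-1)%N.
    by rewrite -!subn1 leq_sub2r // leq_add // size_binpoly.
  by rewrite addSn addnS ltnS.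
have powE (z : {poly A}) : log_coef z k = \sum_(m < k.+1) lam m *: (z ^+ m)`_k.
  rewrite cE; under [RHS]eq_bigr => m _ do
    rewrite (expr_sub1_wide z (ltn_ord m)) coef_sum scaler_sumr.
  rewrite exchange_big /=; apply: eq_bigr => i _.
  have -> : c i = \sum_(m < k.+1) lam m * ('C(m, i) * 'C(m, 0))%:R.
    rewrite cM ?addn0 -1?ltnS // /c /(binpoly F 0) big_ord0 coef1 mulr0 addr0.
    by rewrite mul1r.
  rewrite scaler_suml; apply: eq_bigr => m _.
  by rewrite bin0 muln1 coefMn -scaler_nat scalerA.
move=> p0 q0 pq; set x := p - 1; set y := q - 1.
have x0 : x`_0 = 0 by rewrite coefB p0 coef1 subrr.
have y0 : y`_0 = 0 by rewrite coefB q0 coef1 subrr.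
transitivity (\sum_(i < k.+1) \sum_(j < k.+1)
   ((j == 0 :> nat)%:R * c i + (i == 0 :> nat)%:R * c j) *: (x ^+ i * y ^+ j)`_k).
  rewrite powE; under eq_bigr => m _.
    rewrite exprMn_comm // !(expr_sub1_wide _ (ltn_ord m)).
    rewrite mulr_suml coef_sum scaler_sumr.
    under eq_bigr do rewrite mulr_sumr coef_sum scaler_sumr.
    over.
  rewrite exchange_big /=; apply: eq_bigr => i _.
  rewrite exchange_big /=; apply: eq_bigr => j _.
  have [kij|ijk] := ltnP k (i + j).
    have xy0 : (x ^+ i * y ^+ j)`_k = 0.
      by apply: coefM_low kij => l; apply: coefX_low.
    rewrite xy0 scaler0 big1 // => m _.
    by rewrite mulrnAl mulrnAr !coefMn xy0 !mul0rn scaler0.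
  rewrite -cM // scaler_suml; apply: eq_bigr => m _.
  by rewrite mulrnAl mulrnAr -mulrnA coefMn mulnC -scaler_nat scalerA.
under eq_bigr do under eq_bigr do rewrite scalerDl.
under eq_bigr do rewrite big_split /=.
rewrite big_split /= !cE; congr (_ + _).
  apply: eq_bigr => i _; rewrite big_ord_recl big1 ?addr0 /= => [|j _].
    by rewrite mul1r mulr1.
  by rewrite mul0r scale0r.
rewrite big_ord_recl [X in _ + X]big1 ?addr0 => [|i _] /=.
  by apply: eq_bigr => j _; rewrite !mul1r.
by rewrite big1 // => j _; rewrite mul0r scale0r.
Qed.
End LogAdditive.

Section LogMorphism.
Variables (F : fieldType) (A B : algType F) (h : {lrmorphism A -> B}).

Lemma log_coef_map (p : {poly A}) k :
  log_coef (map_poly h p) k = h (log_coef p k).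
Proof.
rewrite /log_coef raddf_sum; apply: eq_bigr => j _.
rewrite -(rmorph1 (map_poly h)) -rmorphB -rmorphXn coef_map.
exact: esym (linearZZ h _ _).
Qed.

End LogMorphism.

Lemma log_coef1 (F : fieldType) (A : algType F) k :
  log_coef (1 : {poly A}) k = 0.
Proof.
rewrite /log_coef subrr big_nat big1 // => -[|j] // _.
by rewrite expr0n coef0 scaler0.
Qed.

(** * Functions of a set of bounded degree *)

Section Degree.
Variable T : finType.

(** A function of M : {set T} is a polynomial in the membership indicators of M;
    its degree is at most d when only monomials indexed by sets of at most d
    points occur. The weight g is the family of coefficients, that is, the
    Moebius transform of f. *)
Definition deg_le (V : zmodType) d (f : {set T} -> V) :=
  exists2 g : {set T} -> V, forall N : {set T}, (d < #|N|)%N -> g N = 0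
    & forall M, f M = \sum_(N : {set T} | N \subset M) g N.

Lemma eq_deg_le (V : zmodType) d (f f' : {set T} -> V) :
  f =1 f' -> deg_le d f -> deg_le d f'.
Proof. by move=> ff' [g g0 gE]; exists g => // M; rewrite -ff'. Qed.

Lemma deg_le_cst (V : zmodType) d (c : V) : deg_le d (fun=> c).
Proof.
exists (fun N => if N == set0 then c else 0) => [N|M].
  by case: eqP => // ->; rewrite cards0.
rewrite (bigD1 set0) ?sub0set //= eqxx big1 ?addr0 // => N /andP[_].
by move/negPf->.
Qed.

Lemma deg_le_raddf (V W : zmodType) (h : {additive V -> W}) d (f : {set T} -> V) :
  deg_le d f -> deg_le d (fun M => h (f M)).
Proof.
move=> [g g0 gE]; exists (fun N => h (g N)) => [N /g0->|M]; first exact: raddf0.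
by rewrite gE raddf_sum.
Qed.

Lemma deg_le_sum (V : zmodType) I (r : seq I) (P : pred I) d
    (f : I -> {set T} -> V) :
  (forall i, P i -> deg_le d (f i)) ->
  deg_le d (fun M => \sum_(i <- r | P i) f i M).
Proof.
move=> df; elim: r => [|i r IHr].
  by apply: eq_deg_le (deg_le_cst d 0) => M; rewrite big_nil.
have [Pi|nPi] := boolP (P i); last first.
  by apply: eq_deg_le IHr => M; rewrite big_cons (negPf nPi).
have [g g0 gE] := df i Pi; have [g' g'0 g'E] := IHr.
exists (fun N => g N + g' N) => [N Nd|M]; first by rewrite g0 // g'0 // addr0.
by rewrite big_cons Pi gE g'E big_split.
Qed.

(** The product of the monomials of N1 and N2 is the monomial of N1 :|: N2,
    since indicators are idempotent. *)
Lemma deg_leM (A : nzRingType) d d' (f f' : {set T} -> A) :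
  deg_le d f -> deg_le d' f' -> deg_le (d + d') (fun M => f M * f' M).
Proof.
move=> [g g0 gE] [g' g'0 g'E].
exists (fun N => \sum_(p : {set T} * {set T} | p.1 :|: p.2 == N) g p.1 * g' p.2).
  move=> N dN; apply: big1 => -[N1 N2] /= /eqP NE.
  have [d1|d1] := ltnP d #|N1|; first by rewrite g0 ?mul0r.
  rewrite g'0 ?mulr0 // -(ltn_add2l d) (leq_trans dN) // -NE.
  by rewrite (leq_trans (leq_card_setU _ _)) ?leq_add2r.
move=> M; rewrite gE g'E big_distrlr pair_big /=.
rewrite (partition_big (fun p => p.1 :|: p.2) (fun N => N \subset M)) /=.
  apply: eq_bigr => N NM; apply: eq_bigl => -[N1 N2] /=.
  by case: eqP => [NE|]; rewrite ?andbF // andbT -subUset NE NM.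
by move=> [N1 N2] /=; rewrite subUset.
Qed.

(** Each power of the formal variable pays for at most one point of the set. *)
Definition graded (A : nzRingType) (Q : {set T} -> {poly A}) :=
  forall i, deg_le i (fun M => (Q M)`_i).

Lemma deg_le_log_coef (F : fieldType) (A : algType F)
    (Q : {set T} -> {poly A}) k :
  graded Q -> deg_le k (fun M => log_coef (Q M) k).
Proof.
move=> gQ.
have gX j : graded (fun M => (Q M - 1) ^+ j).
  elim: j => [|j IHj] i.
    by apply: eq_deg_le (deg_le_cst i (1 : {poly A})`_i).
  pose f (l : 'I_i.+1) M := (Q M - 1)`_l * ((Q M - 1) ^+ j)`_(i - l).
  apply: (@eq_deg_le _ _ (fun M => \sum_l f l M)) => [M|].
    by rewrite exprS coefM.
  apply: deg_le_sum => l _; have li : (l <= i)%N by rewrite -ltnS.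
  rewrite -[X in deg_le X](subnKC li); apply: deg_leM; last exact: IHj.
  have [g g0 gE] := gQ l; have [h h0 hE] := deg_le_cst l (1 : {poly A})`_l.
  exists (fun N => g N - h N) => [N lN|M]; first by rewrite g0 // h0 // subr0.
  by rewrite sumrB -gE -hE coefB.
apply: deg_le_sum => j _.
exact: (deg_le_raddf ( *:%R ((-1) ^+ (j - 1) / j%:R : F)) (gX j k)).
Qed.

End Degree.

(** * Additive functions of sets of points of a circle *)

Section Arcs.
Variable n : nat.
Local Notation I := 'I_n.+2.
Implicit Types (x y m e : I) (M N : {set I}).

Lemma val_add1 x : (x.+1 < n.+2)%N -> (x + 1 : I) = x.+1 :> nat.
Proof. by move=> lx; rewrite /= modnDmr addn1 modn_small. Qed.

Lemma val_sub1 x : x != 0 -> (x - 1 : I) = x.-1 :> nat.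
Proof.
move=> x0; have x_gt0 : (0 < x)%N by rewrite lt0n.
have lx : (x.-1 < n.+2)%N by rewrite (leq_ltn_trans (leq_pred x)).
have xE : x = Ordinal lx + 1.
  by apply/val_inj/esym; apply: etrans (val_add1 _) _; rewrite /= prednK.
by rewrite {1}xE addrK.
Qed.

Lemma ord_natr x : x = (x : nat)%:R.
Proof.
elim: {x}(x : nat) {-2}x (erefl (x : nat)) => [|i IHi] x xi.
  by apply: val_inj; rewrite xi.
have x1i : (x - 1 : I) = i :> nat by rewrite val_sub1 ?xi // -val_eqE /= xi.
by rewrite xi -[i.+1]addn1 natrD -x1i -(IHi _ x1i) subrK.
Qed.

(** The points m, m + 1, ..., m + l - 1 of the discrete circle Z/(n + 2):
    (x - m) is the clockwise distance from m to x. *)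
Definition arc m (l : nat) : {set I} := [set x : I | ((x - m)%R < l)%N].

Lemma card_arc m l : (l <= n.+2)%N -> #|arc m l| = l.
Proof.
move=> ln; have -> : arc m l = [set x + m | x in [set x : I | (x < l)%N]].
  apply/setP=> x; rewrite inE; apply/idP/imsetP => [xl|[y]].
    by exists (x - m); rewrite ?inE ?subrK.
  by rewrite inE => yl ->; rewrite addrK.
rewrite card_imset; last exact: addIr.
rewrite cardsE -sum1_card -[RHS]card_ord -sum1_card.
by rewrite (big_ord_widen _ (fun=> 1%N) ln).
Qed.

Lemma val_opp1 : (- 1 : I) = n.+1 :> nat.
Proof. by rewrite /= [(1 %% _)%N]modn_small // subn1 modn_small. Qed.

Lemma pred_notin_arc m l : (l < n.+2)%N -> m - 1 \notin arc m l.
Proof.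
by move=> ln; rewrite inE addrAC subrr sub0r val_opp1 -leqNgt.
Qed.

Lemma exists_start N :
  N != set0 -> N != setT -> exists2 m, m \in N & m - 1 \notin N.
Proof.
case/set0Pn=> a aN NT; apply/exists_inP; apply: contraR NT => /exists_inPn NP.
rewrite -subTset; apply/subsetP=> y _.
have aP i : a - i%:R \in N.
  elim: i => [|i IHi]; first by rewrite subr0.
  by rewrite -[i.+1]addn1 natrD opprD addrA -[_ \in _]negbK NP.
by rewrite -(subKr a y) [a - y]ord_natr.
Qed.

(** Two holes m and e of M cut the circle into the open arcs from m to e and
    from e to m; these are the parts of M lying in each of them. *)
Definition before m e M := [set x in M | ((x - m)%R < (e - m)%R)%N].
Definition after m e M := [set x in M | ((e - m)%R < (x - m)%R)%N].

Lemma val_sub_pred m x :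
  x != m - 1 -> (x - (m - 1))%R = (x - m)%R.+1 :> nat.
Proof.
move=> xm; rewrite opprB addrCA addrC; apply: val_add1.
have := ltn_ord (x - m); rewrite leq_eqVlt => /predU1P[E|//].
case/eqP: xm; rewrite -[x](subrK m) addrC; congr (_ + _); apply: val_inj.
by apply: etrans (_ : n.+1 = _); [case: E | exact: esym val_opp1].
Qed.

Variables (V : zmodType) (k : nat) (f g : {set I} -> V).
Hypotheses (k_gt0 : (0 < k)%N) (ltkn : (k < n.+2)%N).
Hypothesis gE : forall M, f M = \sum_(N : {set I} | N \subset M) g N.
Hypothesis gk : forall N, (k < #|N|)%N -> g N = 0.
Hypothesis f0 : f set0 = 0.
Hypothesis fD : forall m e M,
  m \notin M -> e \notin M -> f M = f (before m e M) + f (after m e M).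

Lemma weight_set0 : g set0 = 0.
Proof. by rewrite -f0 gE (big_pred1 set0) // => N; apply: subset0. Qed.

(** Additivity of f says that the weights of the subsets of N add up to those of
    the subsets of its two parts; hence no weight is left for N itself. *)
Lemma weight_split m e N : m \notin N -> e \notin N ->
  before m e N != set0 -> after m e N != set0 -> g N = 0.
Proof.
have [c] := ubnP #|N|; elim: c N => // c IHc N cN mN eN.
set N1 := before m e N; set N2 := after m e N => N10 N20.
have N1S : N1 \subset N by apply/subsetP=> x; rewrite inE => /andP[].
have N2S : N2 \subset N by apply/subsetP=> x; rewrite inE => /andP[].
have N12 x : x \in N -> (x \in N2) = (x \notin N1).
  move=> xN; rewrite !inE xN /= -leqNgt ltn_neqAle.
  case: eqP => // ex; have {}ex : x = e by apply/(addIr (- m))/val_inj.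
  by rewrite -ex xN in eN.
have N1P : ~~ (N \subset N1).
  apply: contra N20 => /subsetP NN1; rewrite -subset0; apply/subsetP=> x xN2.
  by have xN := subsetP N2S x xN2; rewrite N12 // NN1 in xN2.
have N2P : ~~ (N \subset N2).
  apply: contra N10 => /subsetP NN2; rewrite -subset0; apply/subsetP=> x xN1.
  by have xN := subsetP N1S x xN1; have := NN2 x xN; rewrite N12 ?xN1.
(* By induction a proper subset meeting both parts has weight 0, so the
   remaining weight of N is that of N1 plus that of N2. *)
have subsE N' : N' \subset N -> N' != N -> g N' =
    (if N' \subset N1 then g N' else 0) + (if N' \subset N2 then g N' else 0).
  move=> N'S N'N.
  have [->|N'0] := eqVneq N' set0; first by rewrite !sub0set weight_set0 addr0.
  have b_sub : (N' \subset N1) = (after m e N' == set0).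
    rewrite -subset0; apply/subsetP/subsetP => S x.
      rewrite inE => /andP[xN' xe]; have xN := subsetP N'S x xN'.
      by have := S x xN'; rewrite -[x \in N1]negbK -N12 // inE xN xe.
    move=> xN'; have xN := subsetP N'S x xN'; rewrite -[_ \in N1]negbK -N12 //.
    apply/negP; rewrite inE => /andP[_ xe].
    by have := S x; rewrite !inE xN' xe => /(_ isT).
  have a_sub : (N' \subset N2) = (before m e N' == set0).
    rewrite -subset0; apply/subsetP/subsetP => S x.
      rewrite inE => /andP[xN' xe]; have xN := subsetP N'S x xN'.
      by have := S x xN'; rewrite N12 // inE xN xe.
    move=> xN'; have xN := subsetP N'S x xN'; rewrite N12 //.
    apply/negP; rewrite inE => /andP[_ xe].
    by have := S x; rewrite !inE xN' xe => /(_ isT).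
  rewrite b_sub a_sub; case: eqVneq => [a0|a0]; case: eqVneq => [b0|b0].
  - case/set0Pn: N'0 => x xN'; have := xN'; have := subsetP N'S x xN' => xN.
    have: N' \subset N1 by rewrite b_sub a0.
    have: N' \subset N2 by rewrite a_sub b0.
    by move=> /subsetP/(_ x xN'); rewrite N12 // => /negP xN1 /subsetP/(_ x xN').
  - by rewrite addr0.
  - by rewrite add0r.
  rewrite addr0; apply: IHc => //.
  + by apply: (@leq_trans #|N|) => //; rewrite proper_card // properEneq N'N.
  + by apply: contra mN => /(subsetP N'S).
  + by apply: contra eN => /(subsetP N'S).
have := fD mN eN; rewrite -/N1 -/N2 !gE (bigD1 N) //=.
have subE (N3 : {set I}) : N3 \subset N -> ~~ (N \subset N3) ->
    \sum_(N' : {set I} | (N' \subset N) && (N' != N))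
       (if N' \subset N3 then g N' else 0) = \sum_(N' : {set I} | N' \subset N3) g N'.
  move=> N3S N3P; rewrite -big_mkcondr; apply: eq_bigl => N'.
  apply: andb_idl => N'3; rewrite (subset_trans N'3 N3S) /=.
  by apply: contraNneq N3P => <-.
rewrite (eq_bigr _ (fun N' H => subsE N' (proj1 (andP H)) (proj2 (andP H)))).
by rewrite big_split /= !subE // => /(canRL (addrK _)) ->; rewrite subrr.
Qed.

Lemma sum_arc_start m : f (arc m k) - f (arc (m + 1) k.-1)
  = \sum_(N : {set I} | (m \in N) && (N \subset arc m k)) g N.
Proof.
have subE N : (N \subset arc (m + 1) k.-1) = (m \notin N) && (N \subset arc m k).
  have inE1 x : (x \in arc (m + 1) k.-1) = (x != m) && (x \in arc m k).
    rewrite !inE opprD addrA; have [->|xm] := eqVneq x m.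
      have := pred_notin_arc m (leq_ltn_trans (leq_pred k) ltkn).
      by rewrite inE addrAC => /negPf.
    have v0 : (0 < (x - m)%R)%N.
      by rewrite lt0n -[0%N]/(nat_of_ord (0 : I)) val_eqE subr_eq0.
    by rewrite val_sub1 ?subr_eq0 // -ltnS !prednK.
  apply/subsetP/andP => [S|[mN /subsetP S] x xN].
    split; last by apply/subsetP=> x /S; rewrite inE1 => /andP[].
    by apply/negP=> /S; rewrite inE1 eqxx.
  by rewrite inE1 S // andbT; apply: contraNneq mN => <-.
rewrite !gE (bigID [pred N : {set I} | m \in N]) /= addrC.
rewrite [X in _ - X](eq_bigl _ _ subE).
under [X in X + _ - _]eq_bigl do rewrite andbC.
by rewrite addrAC subrr add0r; apply: eq_bigl => N; rewrite andbC.
Qed.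

(** A set with nonzero weight has at most k points and is not cut by two of its
    holes, so it is a single run of consecutive points, and it has exactly one
    first point m. The difference f (arc m k) - f (arc (m + 1) k.-1) collects
    the weights of the runs that start at m. *)
Lemma sum_arcs :
  f setT = \sum_(m : I) (f (arc m k) - f (arc (m + 1) k.-1)).
Proof.
under eq_bigr do rewrite sum_arc_start.
rewrite (exchange_big_dep xpredT) //= gE; apply: eq_big => [N|N _].
  by rewrite subsetT.
have [->|N0] := eqVneq N set0; first by rewrite weight_set0 big1.
have [->|gN] := eqVneq (g N) 0; first by rewrite big1.
have cN : (#|N| <= k)%N by rewrite leqNgt; apply: contra_neqN gN; apply: gk.
have NT : N != setT.
  by apply: contraTneq cN => ->; rewrite cardsT card_ord -ltnNge.
have start_pred m : N \subset arc m k -> m - 1 \notin N.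
  by move/subsetP=> S; apply: contra (pred_notin_arc m ltkn); apply: S.
have neq1 x y : x \in N -> y \notin N -> x != y.
  by move=> xN; apply: contraNneq => <-.
have [m mN m1N] := exists_start N0 NT.
(* If some point x of N were k or more steps after the start m, then, N having
   at most k points, one of the k points of arc m k would be a hole e, and the
   holes m - 1 and e would cut N between m and x. *)
have Nm : N \subset arc m k.
  apply/subsetPn => -[x xN xarc].
  have /subsetPn[e earc eN] : ~~ (arc m k \subset N).
    apply: contra xarc => S; suff -> : arc m k = N by [].
    by apply/eqP; rewrite eqEcard S card_arc // ltnW.
  have em : e != m - 1.
    by apply: contraTneq earc => ->; apply: pred_notin_arc.
  case/eqP: gN; apply: (@weight_split (m - 1) e) => //; apply/set0Pn.
    exists m; rewrite inE mN (@val_sub_pred m m) ?neq1 // (@val_sub_pred m e) //.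
    rewrite subrr ltnS lt0n.
    by rewrite -[0%N]/(nat_of_ord (0 : I)) val_eqE subr_eq0 eq_sym neq1.
  exists x; rewrite inE xN (@val_sub_pred m x) ?neq1 // (@val_sub_pred m e) // ltnS.
  by rewrite !inE -leqNgt in earc xarc; apply: leq_trans earc xarc.
(* A second start m' would be separated from m by the holes m - 1 and m' - 1. *)
rewrite (big_pred1 m) // => m'; apply/andP/eqP => [[m'N Nm']|-> //].
apply/eqP; apply: contraTT gN => m'm; rewrite negbK; apply/eqP.
apply: (@weight_split (m - 1) (m' - 1)) => //; rewrite ?start_pred //; apply/set0Pn.
  exists m; rewrite inE mN (@val_sub_pred m) ?neq1 ?start_pred // subrr.
  rewrite opprB addrA subrK ltn_neqAle lt0n -[0%N]/(nat_of_ord (0 : I)) val_eqE.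
  rewrite subr_eq0 m'm andbT.
  have : m' - 1 != m by rewrite eq_sym neq1 ?start_pred.
  apply: contraNneq => /esym m'm1.
  have m'1 : m' - m = 1.
    by apply: val_inj; apply: etrans m'm1 _; rewrite /= modn_small.
  by rewrite subr_eq addrC -subr_eq m'1.
exists m'; rewrite inE m'N (@val_sub_pred m m') ?neq1 ?start_pred //.
by rewrite opprB addrA subrK ltnSn.
Qed.

End Arcs.

(** * Cycles and their rotations *)

Section Chain.
Variable n : nat.
Implicit Types (x y z : 'I_n) (t : seq 'I_n).

Lemma chain1 x : chain [:: x] = 1%g.
Proof. by rewrite /chain big_nil. Qed.

Lemma chain_cons x y t :
  chain [:: x, y & t] = perm_comp (tperm x y) (chain (y :: t)).
Proof. by rewrite /chain /= big_cons. Qed.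

Lemma chain_notin t z : z \notin t -> chain t z = z.
Proof.
case: t => [|x t]; first by rewrite /chain big_nil perm1.
elim: t x => [|y t IHt] x; first by rewrite chain1 perm1.
rewrite inE negb_or chain_cons perm_compE => /andP[zx zt].
rewrite IHt // tpermD 1?eq_sym //.
by apply: contraNneq zt => ->; rewrite mem_head.
Qed.

Lemma chain_nth x0 t i : uniq t -> (i.+1 < size t)%N ->
  chain t (nth x0 t i) = nth x0 t i.+1.
Proof.
case: t => // x t; elim: t x i => // y t IHt x i /=/andP[xyt yt].
rewrite ltnS => it; rewrite chain_cons perm_compE.
case: i it => [|i] it /=; first by rewrite chain_notin ?tpermL.
rewrite ltnS in it; rewrite (IHt y i yt) //= tpermD //.
  by apply: contraNneq xyt => ->; rewrite inE mem_nth ?orbT.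
by case/andP: yt => yt _; apply: contraNneq yt => ->; rewrite mem_nth.
Qed.

Lemma chain_last x t : uniq (x :: t) -> chain (x :: t) (last x t) = x.
Proof.
elim: t x => [|y t IHt] x; first by rewrite chain1 perm1.
by move=> /=/andP[_ yt]; rewrite chain_cons perm_compE IHt ?tpermR.
Qed.

Lemma chain_rcons x t y :
  chain (rcons (x :: t) y) = perm_comp (chain (x :: t)) (tperm (last x t) y).
Proof.
elim: t x => [|z t IHt] x.
  by rewrite /= chain_cons !chain1 /perm_comp mul1g mulg1.
by rewrite !rcons_cons !chain_cons -rcons_cons IHt /perm_comp mulgA.
Qed.

(** A chain is the cyclic permutation of its points, so the point at which the
    cycle is cut open does not matter. *)
Lemma chain_rot1 x t : uniq (x :: t) -> chain (rcons t x) = chain (x :: t).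
Proof.
case: t => // y t /andP[xt ut].
rewrite chain_rcons chain_cons /perm_comp conjgC tpermJ chain_last //.
by rewrite (chain_notin xt) tpermC.
Qed.

Lemma chain_map (s : 'S_n) t : chain (map s t) = (chain t ^ s)%g.
Proof.
case: t => [|x t]; first by rewrite /chain !big_nil conj1g.
elim: t x => [|y t IHt] x; first by rewrite /= !chain1 conj1g.
by rewrite /= !chain_cons -map_cons IHt /perm_comp conjMg tpermJ.
Qed.

End Chain.

Section Cyclic.
Variable n : nat.
Local Notation I := 'I_n.+2.
Local Notation gam := (gamma n.+2).
Implicit Types (x y e : I) (A K M : {set I}).

Lemma gammaE x : gam x = x + 1.
Proof.
have [lx|nx] := ltnP x.+1 n.+2.
  rewrite -{1}(nth_ord_enum ord0 x) chain_nth ?enum_uniq ?size_enum_ord //.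
  by apply: val_inj; apply: etrans (nth_enum_ord _ lx) (esym (val_add1 lx)).
have -> : x = ord_max.
  by apply: val_inj; apply/eqP; rewrite eqn_leq -ltnS ltn_ord.
have maxE : last ord0 (enum I) = ord_max by rewrite enum_ordSr last_rcons.
rewrite /gamma; have := enum_uniq I; rewrite enum_ordSl in maxE *.
move=> uI; rewrite -{1}maxE chain_last //.
by apply: val_inj; rewrite /= modnDmr addn1 modnn.
Qed.

Definition shift A := [set x | x - 1 \in A].

Lemma enum_setE A : enum A = filter (mem A) (enum I).
Proof. by rewrite enumT. Qed.

(** Conjugation by gamma relabels the points. Adding 1 keeps the enumeration of
    A increasing, except that the last point n + 1, if present, becomes 0: the
    list is then rotated, which does not change the cycle. *)
Lemma chain_enum_shift A : chain (enum (shift A)) = (chain (enum A) ^ gam)%g.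
Proof.
pose L := map (lift ord0) (enum 'I_n.+1) : seq I.
have mapL : map gam (enum I) = rcons L 0.
  rewrite enum_ordSr map_rcons -map_comp; congr rcons.
    apply: eq_map => i /=; rewrite gammaE; apply: val_inj.
    apply: etrans (val_add1 (x := widen_ord (leqnSn n.+1) i) _) _ => //=.
    by rewrite ltnS.
  by rewrite gammaE; apply: val_inj; rewrite /= modnDmr addn1 modnn.
rewrite -chain_map !enum_setE.
have -> : map gam (filter (mem A) (enum I)) = filter (mem (shift A)) (map gam (enum I)).
  rewrite [RHS]filter_map; congr (map _ _); apply: eq_filter => x /=.
  by rewrite inE gammaE addrK.
rewrite mapL filter_rcons enum_ordSl /= -/L.
have uL : uniq (ord0 :: L).
  by rewrite -enum_ordSl enum_uniq.
case: ifP => // shA0; rewrite chain_rot1 //=.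
have := filter_uniq (mem (shift A)) uL; rewrite /= shA0; exact.
Qed.

Lemma shiftK A : shift [set x | x + 1 \in A] = A.
Proof. by apply/setP=> x; rewrite !inE subrK. Qed.

(** Skipping e in a cycle that sends e to e + 1 multiplies it by a transposition.
    After a rotation e = 0, and then this is the definition of a chain. *)
Lemma chain_step A e : e \in A -> e + 1 \in A ->
  chain (enum A) = perm_comp (tperm e (e + 1)) (chain (enum (A :\ e))).
Proof.
rewrite [e]ord_natr; elim: (e : nat) A => [|i IHi] A.
  rewrite mulr0n add0r => A0 A1.
  have uI := enum_uniq I; rewrite !enum_setE !enum_ordSl /= in uI *.
  have -> : lift ord0 ord0 = 1 :> I by apply: val_inj; rewrite /= modn_small.
  rewrite /= !inE A0 A1 !eqxx /=.
  rewrite chain_cons; congr (perm_comp _ (chain (_ :: _))).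
  apply: eq_in_filter => x xr; rewrite /= in_setD1 andb_idl // => _.
  by apply: contraTneq xr => ->; case/andP: uI; rewrite inE negb_or => /andP[].
move=> iA i1A; rewrite -[A]shiftK; set A' := [set _ | _].
have i1 : i.+1%:R = i%:R + 1 :> I by rewrite -[i.+1]addn1 natrD.
have -> : shift A' :\ i.+1%:R = shift (A' :\ i%:R).
  by apply/setP=> x; rewrite !inE i1 subr_eq.
rewrite !chain_enum_shift IHi ?inE -?i1 // /perm_comp conjMg tpermJ !gammaE.
by rewrite -i1.
Qed.

(** Edge e joins the points e - 1 and e. For the run of edges e, ..., e + r - 1 of
    K, this permutation acts on the points e - 1, ..., e + r - 1 as the cycle
    sending each point to its predecessor and the first point to the last; the
    points met by no edge of K are fixed. *)
Definition run_perm K : 'S_n.+2 := perm_comp gam^-1 (chain (enum (~: K))).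

Lemma run_perm0 : run_perm set0 = 1%g.
Proof.
rewrite /run_perm setC0 /perm_comp /gamma (_ : enum setT = enum I) ?mulgV //.
by apply: eq_enum => x; rewrite inE.
Qed.

Lemma run_perm_shift K : run_perm (shift K) = (run_perm K ^ gam)%g.
Proof.
rewrite /run_perm /perm_comp (_ : ~: shift K = shift (~: K)).
  by rewrite chain_enum_shift conjMg conjVg [(gam ^ gam)%g]conjgE mulKg.
by apply/setP=> x; rewrite !inE.
Qed.

Lemma run_perm_step K e : e \notin K -> e + 1 \notin K ->
  run_perm (e |: K) = perm_comp (tperm (e - 1) e) (run_perm K).
Proof.
move=> eK e1K; have := @chain_step (~: K) e; rewrite !inE => /(_ eK e1K).
rewrite /run_perm setCU setIC -setDE /perm_comp => ->.
rewrite -!mulgA; congr mulg.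
have -> : tperm e (e + 1) = (tperm (e - 1) e ^ gam)%g.
  by rewrite tpermJ !gammaE subrK.
by rewrite conjgE !mulgA mulgK -mulgA tperm2 mulg1.
Qed.

End Cyclic.

(** * Morphisms of group algebras *)

Section GalgMap.
Variables (F : fieldType) (a b : nat) (phi : 'S_a -> 'S_b).
Hypothesis phiM : {morph phi : s t / (s * t)%g}.

(** The algebra morphism induced by a group morphism phi. Both the conjugation by
    gamma and the embedding pi_embed are of this form. The multiplicativity of
    phi is an argument so that the morphism structures below can be inferred. *)
Definition galg_map of {morph phi : s t / (s * t)%g} :=
  fun f : galg F a => (\sum_(s : 'S_a) (f s : F) *: ge F (phi s) : galg F b).

Lemma galg_expand (f : galg F a) : f = \sum_(s : 'S_a) (f s : F) *: ge F s.
Proof.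
apply/ffunP=> t; rewrite sum_ffunE (bigD1 t) //= big1 => [|s /negPf st].
  by rewrite !ffunE eqxx addr0 /GRing.scale /= mulr1.
by rewrite !ffunE eq_sym st scaler0.
Qed.

Fact galg_map_additive : additive (galg_map phiM).
Proof.
move=> f g; rewrite /galg_map -sumrB; apply: eq_bigr => s _.
by rewrite -scalerBl !ffunE.
Qed.

Fact galg_map_scalable : scalable (galg_map phiM).
Proof.
move=> c f; rewrite /galg_map scaler_sumr; apply: eq_bigr => s _.
by rewrite scalerA !ffunE.
Qed.

Lemma galg_map_ge s : galg_map phiM (ge F s) = ge F (phi s).
Proof.
rewrite /galg_map (bigD1 s) //= ffunE eqxx scale1r big1 ?addr0 // => t /negPf st.
by rewrite ffunE st scale0r.
Qed.

HB.instance Definition _ := GRing.isZmodMorphism.Build _ _ (galg_map phiM)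
  galg_map_additive.
HB.instance Definition _ := GRing.isScalable.Build F _ _ *:%R (galg_map phiM)
  galg_map_scalable.

Fact galg_map_monoid : monoid_morphism (galg_map phiM).
Proof.
split=> [|f g].
  rewrite -[1]/(ge F 1%g) galg_map_ge; congr (ge F _).
  by apply: (mulgI (phi 1%g)); rewrite -phiM !mulg1.
rewrite {1}[f]galg_expand {1}[g]galg_expand mulr_suml raddf_sum.
rewrite [in RHS]/galg_map mulr_suml; apply: eq_bigr => s _.
rewrite mulr_sumr raddf_sum mulr_sumr; apply: eq_bigr => t _.
rewrite -!scalerAl -!scalerAr.
apply: etrans (galg_map_scalable _ _) _; congr (_ *: _).
apply: etrans (galg_map_scalable _ _) _; congr (_ *: _).
by rewrite -!geM galg_map_ge /perm_comp phiM.
Qed.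

HB.instance Definition _ := GRing.isMonoidMorphism.Build _ _ (galg_map phiM)
  galg_map_monoid.
End GalgMap.

Section Conj.
Variables (F : fieldType) (n : nat) (g : 'S_n).

Lemma conjS_morph : {morph (fun s : 'S_n => (s ^ g)%g) : s t / (s * t)%g}.
Proof. by move=> s t; rewrite conjMg. Qed.

Definition conj_alg : {lrmorphism galg F n -> galg F n} := galg_map conjS_morph.

Lemma conj_algE f : conj_alg f = ge F g * f * ge F g^-1%g.
Proof.
rewrite [f in RHS]galg_expand mulr_sumr mulr_suml; apply: eq_bigr => s _.
by rewrite -scalerAr -scalerAl -!geM /perm_comp conjgE.
Qed.

Lemma iter_conj_alg m f :
  iter m conj_alg f = ge F g ^+ m * f * ge F g^-1%g ^+ m.
Proof.
elim: m => [|m IHm]; first by rewrite !expr0 mul1r mulr1.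
by rewrite iterS IHm conj_algE exprS exprSr !mulrA.
Qed.

End Conj.

Section Embed.
Variables (k n : nat) (lekn : (k <= n)%N).

Lemma ext_permE (s : 'S_k) (i : 'I_n) (j : 'I_k) :
  i = j :> nat -> ext_perm lekn s i = s j :> nat.
Proof. by move=> ij; rewrite permE /ext_fun ij valK. Qed.

Lemma ext_perm_out (s : 'S_k) (i : 'I_n) : (k <= i)%N -> ext_perm lekn s i = i.
Proof. by move=> ki; rewrite permE /ext_fun insubN // -leqNgt. Qed.

Lemma ext_permM : {morph (ext_perm lekn) : s t / (s * t)%g}.
Proof.
move=> s t; apply/permP=> i; rewrite permM; apply: val_inj => /=.
have [ik|ki] := ltnP i k; last by rewrite !ext_perm_out.
pose j := Ordinal ik; have sj : ext_perm lekn s i = s j :> nat by apply: ext_permE.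
by rewrite (@ext_permE _ _ j) // (ext_permE _ sj) permM.
Qed.

Lemma ext_perm_tperm (x y : 'I_k) :
  ext_perm lekn (tperm x y) = tperm (widen_ord lekn x) (widen_ord lekn y).
Proof.
apply/permP=> i; apply: val_inj => /=.
have [ik|ki] := ltnP i k; last first.
  rewrite ext_perm_out // tpermD //; rewrite -val_eqE /= ltn_eqF //.
    exact: leq_trans ki.
  exact: leq_trans ki.
have widen_inj : injective (widen_ord lekn).
  by move=> u v /(congr1 val)/= uv; apply: val_inj.
have -> : i = widen_ord lekn (Ordinal ik) by apply: val_inj.
by rewrite (@ext_permE _ _ (Ordinal ik)) // -inj_tperm.
Qed.

End Embed.

(** * The polynomials attached to sets of edges *)

Section Factor.
Variable F : fieldType.

(** The labels e and e + 1 are the points e - 1 and e, the ends of edge e; the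
    variable 'X marks the presence of the edge. *)
Definition edge_factor n (e : nat) : {poly galg F n.+1} :=
  1 + sigma F n e e.+1 *: 'X.

Definition chain_poly n (s : seq nat) := \prod_(e <- s) edge_factor n e.

Lemma scaleX_mul (A : nzRingType) (x y : A) m :
  (x *: 'X) * (y *: 'X^m) = (x * y) *: 'X^(m.+1).
Proof.
by rewrite -scalerAl -commr_polyX -scalerAl -exprSr scalerA.
Qed.

(** Edges with no common point have disjoint transpositions. *)
Lemma edge_factor_comm n i j : (i.+1 < j <= n)%N ->
  edge_factor n i * edge_factor n j = edge_factor n j * edge_factor n i.
Proof.
move=> /andP[ij jn].
have neq x y : (x < y <= n)%N -> inord y != inord x :> 'I_n.+1.
  move=> /andP[xy yn]; rewrite -val_eqE /= !inordK ?gtn_eqF //.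
  by rewrite ltnS ltnW ?(leq_trans xy).
have c : sigma F n i i.+1 * sigma F n j j.+1 = sigma F n j j.+1 * sigma F n i i.+1.
  rewrite /sigma -!geM /perm_comp; congr (ge F _).
  by rewrite /= [RHS]conjgC tpermJ !tpermD //; apply: neq; lia.
rewrite /edge_factor !mulrDl !mulrDr !mul1r !mulr1.
rewrite ![_ *: 'X * (_ *: 'X)](scaleX_mul _ _ 1) c.
by rewrite addrACA.
Qed.

Lemma chain_poly_map k n (lekn : (k.+1 <= n.+1)%N) s :
  all (fun e => 0 < e <= k)%N s ->
  map_poly (galg_map (F := F) (ext_permM lekn)) (chain_poly k s) = chain_poly n s.
Proof.
move=> sP; rewrite /chain_poly rmorph_prod !big_seq; apply: eq_bigr => e es.
have /andP[e0 ek] := allP sP e es.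
rewrite /edge_factor rmorphD rmorph1 -!mul_polyC rmorphM /= map_polyX map_polyC /=.
have widenE x : (x <= k)%N -> widen_ord lekn (inord x) = inord x.
  by move=> xk; apply: val_inj; rewrite /= !inordK // ltnS (leq_trans xk).
by rewrite /sigma galg_map_ge ext_perm_tperm !widenE // (leq_trans (leq_pred e)).
Qed.

End Factor.

Lemma sum_subset_setU1 (V : nmodType) (T : finType) (e : T) (B : {set T})
    (f : {set T} -> V) :
  e \notin B -> \sum_(K : {set T} | K \subset e |: B) f K
    = \sum_(K : {set T} | K \subset B) f K
      + \sum_(K : {set T} | K \subset B) f (e |: K).
Proof.
move=> eB; rewrite (bigID [pred K : {set T} | e \in K]) /= addrC; congr (_ + _).
  by apply: eq_bigl => K; rewrite -subsetD1 setU1K.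
rewrite (reindex_onto (fun K => e |: K) (fun K => K :\ e)) /=; last first.
  by move=> K /andP[_ /setD1K].
apply: eq_bigl => K; rewrite setU11 andbT; apply/andP/idP => [[KB /eqP KE]|KB].
  by rewrite -KE -(setU1K eB) setSD.
by rewrite setUS // setU1K // (contra _ eB) //; apply: subsetP KB e.
Qed.

Lemma iota1_rcons j : iota 1 j.+1 = rcons (iota 1 j) j.+1.
Proof. by rewrite -cats1 -[j.+1]addn1 iotaD add1n addn1. Qed.

Section Partition.
Variables (F : fieldType) (n : nat).
Local Notation I := 'I_n.+2.
Local Notation gam := (gamma n.+2).
Implicit Types (e m : I) (K M : {set I}).

(** For M = setT this is gamma^-1 S_1(u). Since u counts the edges of K, replacing
    setT by M amounts to giving each edge its own variable and setting to 0 the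
    variables of the edges outside M. The whole circle is excluded because S_1
    has no term without points. *)
Definition run_poly M : {poly galg F n.+2} :=
  \sum_(K : {set I} | (K \subset M) && (K != setT)) ge F (run_perm K) *: 'X^#|K|.

Lemma run_poly_graded : graded run_poly.
Proof.
move=> i.
exists (fun K => if (K != setT) && (#|K| == i) then ge F (run_perm K) else 0).
  by move=> K iK; rewrite gtn_eqF // andbF.
move=> M; rewrite coef_sum big_mkcondr; apply: eq_bigr => K _.
rewrite coefZ coefXn [i == _]eq_sym; case: (K != setT) => //=.
by case: eqP => _; rewrite ?mulr1 ?mulr0.
Qed.

Lemma run_poly_coef0 M : (run_poly M)`_0 = 1.
Proof.
rewrite coef_sum (bigD1 set0) /=; last first.
  by rewrite sub0set /=; apply/eqP=> /setP/(_ ord0); rewrite !inE.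
rewrite run_perm0 cards0 coefZ coefXn mulr1 big1 ?addr0 // => K /andP[_ K0].
by rewrite coefZ coefXn [0%N == _]eq_sym cards_eq0 (negPf K0) mulr0.
Qed.

Lemma run_poly_set0 : run_poly set0 = 1.
Proof.
rewrite /run_poly (big_pred1 set0) => [|K].
  by rewrite run_perm0 cards0 expr0 scale1r.
rewrite subset0 andb_idr // => /eqP->.
by apply/eqP=> /setP/(_ ord0); rewrite !inE.
Qed.

Lemma run_poly_shift M : run_poly (shift M) = map_poly (conj_alg F gam) (run_poly M).
Proof.
rewrite {1}/run_poly (reindex (@shift n)) /=; last first.
  exists (fun K => [set x | x + 1 \in K]) => K _; last exact: shiftK.
  by apply/setP=> x; rewrite !inE addrK.
rewrite raddf_sum; apply: eq_big => [K|K _].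
  have inT : (shift K == setT) = (K == setT).
    apply/eqP/eqP => [KT|->]; last by apply/setP=> x; rewrite !inE.
    by apply/setP=> x; have /setP/(_ (x + 1)) := KT; rewrite !inE addrK.
  rewrite inT; congr (_ && _); apply/subsetP/subsetP => KM x.
    by have := KM (x + 1); rewrite !inE addrK.
  by rewrite !inE; apply: KM.
rewrite run_perm_shift /= map_polyZ map_polyXn /= galg_map_ge.
suff -> : #|shift K| = #|K| by [].
rewrite -(card_imset (mem K) (addIr 1)); apply: eq_card => x.
rewrite !inE; apply/idP/imsetP => [xK|[y yK ->]]; last by rewrite addrK.
by exists (x - 1); rewrite ?subrK.
Qed.

Definition low_poly j M : {poly galg F n.+2} :=
  \prod_(e <- rev (iota 1 j) | inord e \in M) edge_factor F n.+1 e.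

(** As long as edge 0, which joins n + 1 to 0, is absent, the circle is cut open
    and the sum over K is the expansion of an ordered product: adjoining to K an
    edge larger than all the others multiplies run_perm K by its transposition
    on the left. *)
Lemma run_poly_prod M : 0 \notin M ->
  run_poly M = low_poly n.+1 M.
Proof.
move=> M0; pose low j := [set x in M | x <= j]%N.
have lowP j : (j <= n.+1)%N ->
    \sum_(K : {set I} | K \subset low j) ge F (run_perm K) *: 'X^#|K|
      = low_poly j M.
  rewrite /low_poly; elim: j => [_|j IHj jn].
    rewrite big_nil (big_pred1 set0) => [|K].
      by rewrite run_perm0 cards0 expr0 scale1r.
    suff -> : low 0%N = set0 by rewrite subset0.
    apply/setP=> x; rewrite !inE leqn0; apply: contraNF M0 => /andP[xM x0].
    by rewrite (_ : 0 = x) //; apply: val_inj; apply: esym (eqP x0).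
  rewrite iota1_rcons rev_rcons big_cons -(IHj (ltnW jn)); set e : I := inord j.+1.
  have eE : e = j.+1 :> nat by rewrite inordK.
  have lowS : low j.+1 = if e \in M then e |: low j else low j.
    apply/setP=> x; case: ifP => eM; rewrite !inE [in LHS]leq_eqVlt ltnS -eE val_eqE.
      by case: eqP => // ->; rewrite eM.
    by case: eqP => // ->; rewrite eM.
  rewrite lowS; case: ifP => // eM.
  have e_low : e \notin low j by rewrite inE eE ltnn andbF.
  rewrite sum_subset_setU1 // /edge_factor mulrDl mul1r mulr_sumr; congr (_ + _).
  apply: eq_bigr => K /subsetP KS.
  have eK : e \notin K by apply: contra e_low; apply: KS.
  have e1K : e + 1 \notin K.
    apply/negP=> /KS; rewrite inE; have [en|ne] := ltnP e.+1 n.+2.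
      by rewrite (val_add1 en) eE ltnNge leqW ?andbF // leqnSn.
    suff -> : e + 1 = 0 by rewrite (negPf M0).
    have en : e.+1 = n.+2 by apply/eqP; rewrite eqn_leq ltn_ord.
    by apply: val_inj; rewrite /= modnDmr addn1 en modnn.
  rewrite scaleX_mul run_perm_step // cardsU1 eK /= geM.
  congr (_ * _ *: _); rewrite /sigma.
  suff <- : e - 1 = inord j by [].
  apply: val_inj; apply: etrans (val_sub1 _) _; first by rewrite -val_eqE /= eE.
  by rewrite eE /= inordK // ltnW.
rewrite -lowP //; apply: eq_bigl => K.
have -> : low n.+1 = M by apply/setP=> x; rewrite inE -ltnS ltn_ord andbT.
rewrite andb_idr // => KM; apply: contraNneq M0 => KT.
by rewrite (subsetP KM) // KT inE.
Qed.

(** Since e is a hole of M, the factors of the edges above e all stand to the left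
    of those of the edges below e. *)
Lemma low_polyM j M e : (j <= n.+1)%N -> e \notin M ->
  low_poly j M = low_poly j (after 0 e M) * low_poly j (before 0 e M).
Proof.
move=> jn eM; rewrite /low_poly; elim: j jn => [_|j IHj jn].
  by rewrite !big_nil mulr1.
rewrite iota1_rcons rev_rcons !big_cons (IHj (ltnW jn)) !inE !subr0 inordK //.
case: ifP => //= jM; case: ltngtP => [ej|je|ej] //=; first by rewrite mulrA.
  suff -> : \prod_(i <- rev (iota 1 j) | inord i \in after 0 e M)
      edge_factor F n.+1 i = 1.
    by rewrite !mul1r.
  rewrite big_seq_cond big_pred0 // => i; apply/negP => /andP[].
  rewrite mem_rev mem_iota inE !subr0 => /andP[_ ij] /andP[_].
  by rewrite inordK //; lia.
by move: eM; rewrite (_ : e = inord j.+1) ?jM // -ej inord_val.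
Qed.

Lemma low_poly_comm j M N e : (j <= n.+1)%N ->
  GRing.comm (low_poly j (after 0 e M)) (low_poly j (before 0 e N)).
Proof.
move=> jn; rewrite /low_poly big_seq_cond [X in GRing.comm _ X]big_seq_cond.
apply: commr_prod => i.
rewrite mem_rev mem_iota => /andP[ij]; rewrite inE !subr0 => /andP[_ ie].
apply/commr_sym/commr_prod => i'.
rewrite mem_rev mem_iota => /andP[i'j]; rewrite inE !subr0 => /andP[_ ie'].
rewrite !inordK in ie ie' *; try lia.
by apply: edge_factor_comm; lia.
Qed.

Variable (k : nat).
Hypothesis charF0 : [pchar F] =i pred0.

Definition run_log M : galg F n.+2 := log_coef (run_poly M) k.

Lemma run_log_shift M : run_log (shift M) = conj_alg F gam (run_log M).
Proof. by rewrite /run_log run_poly_shift log_coef_map. Qed.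

Lemma run_log_cut0 e M : 0 \notin M -> e \notin M ->
  run_log M = run_log (before 0 e M) + run_log (after 0 e M).
Proof.
move=> M0 eM; have aP : run_poly (after 0 e M) = low_poly n.+1 (after 0 e M).
  by apply: run_poly_prod; rewrite inE (negPf M0).
have bP : run_poly (before 0 e M) = low_poly n.+1 (before 0 e M).
  by apply: run_poly_prod; rewrite inE (negPf M0).
have MP : run_poly M = run_poly (after 0 e M) * run_poly (before 0 e M).
  by rewrite aP bP -low_polyM // run_poly_prod.
rewrite addrC /run_log MP.
apply: (log_coefM charF0); [exact: run_poly_coef0 | exact: run_poly_coef0 |].
by rewrite aP bP; apply: low_poly_comm.
Qed.

(** Edge sets on the two sides of the holes m and e have disjoint supports. The
    hole m is brought to 0 by rotation. *)
Lemma run_log_cut m e M : m \notin M -> e \notin M ->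
  run_log M = run_log (before m e M) + run_log (after m e M).
Proof.
rewrite [m]ord_natr; elim: (m : nat) e M => [|i IHi] e M; first exact: run_log_cut0.
rewrite -[i.+1]addn1 natrD => iM eM; pose M' := [set x | x + 1 \in M].
have sub1 x y : x - (y + 1) = x - 1 - y by rewrite opprD addrA addrAC.
have -> : before (i%:R + 1) e M = shift (before i%:R (e - 1) M').
  by apply/setP=> x; rewrite !inE subrK !sub1.
have -> : after (i%:R + 1) e M = shift (after i%:R (e - 1) M').
  by apply/setP=> x; rewrite !inE subrK !sub1.
by rewrite -{1}[M]shiftK -/M' !run_log_shift -raddfD -IHi // inE ?subrK.
Qed.

Lemma arc_shift m l : arc (m + 1) l = shift (arc m l).
Proof. by apply/setP=> x; rewrite !inE opprD addrA addrAC. Qed.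

Lemma run_log_arc (i : nat) m l :
  run_log (arc (i%:R + m) l) = iter i (conj_alg F gam) (run_log (arc m l)).
Proof.
elim: i => [|i IHi]; first by rewrite add0r.
by rewrite iterS -IHi -run_log_shift -arc_shift -[i.+1]addn1 natrD addrAC.
Qed.

End Partition.

(** * The generating polynomial of the cycle sums *)

Lemma sorted_enum_ord n (A : {set 'I_n}) : sorted ltn [seq val i | i <- enum A].
Proof.
rewrite sorted_map {1}/enum_mem; apply: sorted_filter.
  by move=> i j l; apply: ltn_trans.
by rewrite -sorted_map -enumT val_enum_ord iota_ltn_sorted.
Qed.

Lemma enum_of_sorted n (t : seq 'I_n) :
  sorted ltn [seq val i | i <- t] -> enum [set x in t] = t.
Proof.
move=> st; apply: (inj_map val_inj); apply: (irr_sorted_eq ltn_trans ltnn) => //.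
  exact: sorted_enum_ord.
move=> i; apply/mapP/mapP => -[x]; last first.
  by move=> xt ->; exists x; rewrite // mem_enum inE.
by rewrite mem_enum inE => xt ->; exists x.
Qed.

Lemma G_sets (F : fieldType) n r :
  G F n.+1 r = \sum_(A : {set 'I_n.+1} | #|A| == r) ge F (chain (enum A)).
Proof.
pose h (A : {set 'I_n.+1}) : r.-tuple 'I_n.+1 :=
  insubd [tuple of nseq r ord0] (enum A).
have hE (A : {set 'I_n.+1}) : #|A| = r -> h A = enum A :> seq _.
  by move=> Ar; rewrite /h val_insubd -cardE Ar eqxx.
rewrite /G (reindex_onto h (fun t => [set x in t])) /=.
  apply: eq_big => [A|A]; last first.
    by move=> /andP[st /eqP AE]; rewrite -[A in RHS]AE enum_of_sorted.
  apply/andP/eqP => [[st /eqP AE]|Ar].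
    by rewrite -[A]AE cardE enum_of_sorted // size_tuple.
  rewrite hE // sorted_enum_ord; split=> //; apply/eqP/setP=> x.
  by rewrite inE memtE hE ?mem_enum.
move=> t st; apply: val_inj; rewrite /= hE ?enum_of_sorted //.
by rewrite cardE enum_of_sorted ?size_tuple.
Qed.

Section TransferMatrix.
Variables (F : fieldType) (n : nat).
Local Notation I := 'I_n.+2.
Local Notation gam := (gamma n.+2).

Lemma run_poly_setT : run_poly F [set: I] = ge F gam^-1%g *: S1 F n.+2.
Proof.
pose H r : {poly galg F n.+2} :=
  \sum_(A : {set I} | #|A| == r) ge F (chain (enum A)) *: 'X^(n.+2 - r).
have -> : S1 F n.+2 = \sum_(1 <= r < n.+3) H r.
  rewrite big_ltn // /S1; congr (_ + _); last first.
    by apply: eq_big_nat => r _; rewrite G_sets scaler_suml.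
  rewrite /H -scaler_suml; congr (_ *: _).
  (* The leading coefficient n counts the singletons, whose chain is 1. *)
  rewrite (eq_bigr (fun _ => 1)) => [|A /cards1P[x ->]].
    2: by rewrite enum_set1 chain1.
  rewrite sumr_const; congr (1 *+ _).
  by rewrite -[LHS]bin1 -[X in 'C(X, _)]card_ord -card_draws cardsE.
rewrite (exchange_big_dep xpredT) //= scaler_sumr /run_poly.
rewrite (reindex_inj (@setC_inj _)) big_mkcond /=; apply: eq_bigr => A _.
under eq_bigl do rewrite eq_sym.
rewrite big_nat1_eq subsetT -setC0 (inj_eq (@setC_inj _)) -card_gt0 ltnS.
have -> : (#|A| <= n.+2)%N by rewrite -[X in (_ <= X)%N]card_ord max_card.
rewrite andbT; case: (0 < #|A|)%N; last by rewrite scaler0.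
by rewrite scalerA -geM /run_perm setCK cardsCs setCK card_ord.
Qed.

Lemma run_poly_linear (M : {set I}) (a b : nat) :
  (0 < a)%N -> (a + b <= n.+2)%N ->
  (forall x, (x \in M) = (a <= x < a + b)%N) ->
  run_poly F M = chain_poly F n.+1 (rev (iota a b)).
Proof.
move=> a0 abn MP; rewrite run_poly_prod; last by rewrite MP /=; lia.
rewrite /low_poly /chain_poly -big_filter filter_rev; congr (\prod_(e <- rev _) _).
apply: (irr_sorted_eq ltn_trans ltnn).
- by apply: sorted_filter; [exact: ltn_trans | exact: iota_ltn_sorted].
- exact: iota_ltn_sorted.
move=> e; rewrite mem_filter !mem_iota MP add1n.
apply/andP/idP => [[+ /andP[_ en]]|eab].
  by rewrite inordK.
by rewrite inordK; lia.
Qed.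

Lemma run_poly_arc1 k : (k < n.+2)%N ->
  run_poly F (arc (1 : I) k) = chain_poly F n.+1 (rev (iota 1 k)).
Proof.
move=> kn; apply: run_poly_linear; rewrite ?add1n // => x.
have [->|x0] := eqVneq x 0.
  by rewrite -(subrr 1) (negPf (pred_notin_arc _ kn)) subrr.
have x_gt0 : (0 < x)%N by rewrite lt0n.
by rewrite inE val_sub1 //; lia.
Qed.

Lemma run_poly_arc2 k : (0 < k < n.+2)%N ->
  run_poly F (arc (1 + 1 : I) k.-1) = chain_poly F n.+1 (rev (iota 2 k.-1)).
Proof.
move=> /andP[k0 kn]; apply: run_poly_linear => // [|x]; first lia.
have pk : (k.-1 < n.+2)%N by lia.
have one : (1 : I) = 1%N :> nat by [].
rewrite inE opprD addrA.
have [->|x0] := eqVneq x 0.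
  rewrite sub0r val_sub1 ?oppr_eq0 ?oner_eq0 // val_opp1 /=; lia.
have [->|x1] := eqVneq x 1; first by rewrite subrr sub0r val_opp1 one; lia.
have x_gt1 : (1 < x)%N.
  have : (x : nat) != 1%N by rewrite -one val_eqE.
  have : (x : nat) != 0%N by rewrite -[0%N]/(nat_of_ord (0 : I)) val_eqE.
  lia.
by rewrite !val_sub1 // ?subr_eq0 //; lia.
Qed.

Variable k : nat.
Hypotheses (charF0 : [pchar F] =i pred0) (k0 : (0 < k)%N) (kn : (k < n.+1)%N).

(** The contribution to log (gamma^-1 S_1) of the runs of edges that start at
    edge 1: all runs inside edges 1, ..., k, minus those inside 2, ..., k. *)
Definition theta : galg F k.+1 :=
  log_coef (chain_poly F k (rev (iota 1 k))) k
  - log_coef (chain_poly F k (rev (iota 2 k.-1))) k.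

Lemma I_elt_theta (lekn : (k.+1 <= n.+2)%N) :
  I_elt F n.+2 k = \sum_(0 <= m < n.+2)
     ge F gam ^+ m * pi_embed lekn theta * ge F gam^-1%g ^+ m.
Proof.
have kn2 : (k < n.+2)%N by exact: ltnW.
have fT : I_elt F n.+2 k = run_log F k [set: I] by rewrite /I_elt -run_poly_setT.
have f0 : run_log F k (set0 : {set I}) = 0.
  by rewrite /run_log run_poly_set0 log_coef1.
have [g gk gE] : deg_le k (run_log F (n := n) k)
  := deg_le_log_coef k (@run_poly_graded F n).
rewrite fT (sum_arcs k0 kn2 gE gk f0); last by move=> m e M; apply: run_log_cut.
(* Starting the arcs at m + 1 keeps edge 0 out of the arc of the term m = 0,
   which then lives on the first k + 1 points. *)
rewrite (reindex_inj (addIr 1)) big_mkord /=; apply: eq_bigr => m _.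
rewrite [m in LHS]ord_natr -[_ + 1 + 1]addrA.
rewrite (run_log_arc F k m 1 k) (run_log_arc F k m (1 + 1) k.-1).
pose h : {lrmorphism galg F k.+1 -> galg F n.+2} := galg_map (ext_permM lekn).
have hP s :
  all (fun e => 0 < e <= k)%N s ->
    log_coef (chain_poly F n.+1 s) k = h (log_coef (chain_poly F k s) k).
  by move=> sP; rewrite -(chain_poly_map F lekn sP); apply: log_coef_map.
have f1 : run_log F k (arc (1 : I) k)
    = h (log_coef (chain_poly F k (rev (iota 1 k))) k).
  rewrite /run_log run_poly_arc1; last exact: kn2.
  by apply: hP; apply/allP=> e; rewrite mem_rev mem_iota; lia.
have f2 : run_log F k (arc (1 + 1 : I) k.-1)
    = h (log_coef (chain_poly F k (rev (iota 2 k.-1))) k).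
  rewrite /run_log run_poly_arc2; last by rewrite k0.
  by apply: hP; apply/allP=> e; rewrite mem_rev mem_iota; lia.
have -> : pi_embed lekn theta
    = run_log F k (arc (1 : I) k) - run_log F k (arc (1 + 1 : I) k.-1).
  by rewrite f1 f2 -raddfB.
move: (run_log F k _) (run_log F k _) => x y.
by rewrite !iter_conj_alg mulrBr mulrBl.
Qed.

End TransferMatrix.

Section Density.
Variables (F : fieldType) (charF0 : [pchar F] =i pred0).

Lemma theta_is_theta k : (0 < k)%N -> is_theta (theta F k).
Proof.
move=> k0 [|[|n]] hn; first by [].
  by case: k k0 hn.
by apply: (I_elt_theta charF0 k0).
Qed.

Lemma theta1 : theta F 1 = sigma F 1 1 2.
Proof.
rewrite /theta /chain_poly big_seq1 big_nil log_coef1 subr0 /log_coef.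
rewrite big_nat1 expr0 divr1 scale1r expr1 /edge_factor addrAC subrr add0r.
by rewrite coefZ coefX mulr1.
Qed.

Lemma sigma_sqr m a b : sigma F m a b * sigma F m a b = 1.
Proof. by rewrite /sigma -geM /perm_comp tperm2. Qed.

Lemma theta2 : theta F 2 = (2%:R : F)^-1 *:
  (sigma F 2 2 3 * sigma F 2 1 2 - sigma F 2 1 2 * sigma F 2 2 3 - 1).
Proof.
have n2 : 2%:R != 0 :> F by rewrite ((pcharf0P F).1 charF0).
have log2 (p : {poly galg F 3}) : p`_0 = 1 ->
    log_coef p 2 = p`_2 - (2%:R : F)^-1 *: (p`_1 * p`_1).
  move=> p0; rewrite /log_coef big_ltn // big_nat1 subnn expr0 divr1 scale1r !expr1.
  rewrite mulN1r scaleNr expr2 coefM !big_ord_recl big_ord0 /bump /= !coefB !coef1.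
  by rewrite p0 /bump /= subrr mul0r mulr0 !subr0 !addr0 !add0r.
have e1 : chain_poly F 2 (rev (iota 1 2)) = edge_factor F 2 2 * edge_factor F 2 1.
  by rewrite /chain_poly /= /rev /= big_cons big_seq1.
have e2 : chain_poly F 2 (rev (iota 2 1)) = edge_factor F 2 2.
  by rewrite /chain_poly /= /rev /= big_seq1.
have := sigma_sqr 2 1 2; have := sigma_sqr 2 2 3.
rewrite /theta e1 e2 /edge_factor; move: (sigma F 2 1 2) (sigma F 2 2 3) => s t tt ss.
rewrite mulrDl mul1r mulrDr mulr1 (scaleX_mul t s 1).
rewrite !log2; try by rewrite !coefD !coefZ !coefX ?coefXn coef1 /= !mulr0 !addr0.
  rewrite !coefD !coefZ !coefX !coefXn !coef1 /= !mulr0 !mulr1 !add0r !addr0 opprK.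
rewrite -{1}[t * s](scalerK n2) scaler_nat mulr2n -scalerBr -scalerDr.
congr (_ *: _); rewrite mulrDr !mulrDl ss tt.
rewrite [1 + t * s]addrC -[t * s + 1 + _]addrA addrKA.
by rewrite [1 + (_ + _)]addrC opprD addrA subrK opprD addrA.
Qed.
End Density.

Theorem theorem8p4 (R : realType) :
  [/\ forall k : nat, (0 < k)%N ->
        exists theta : galg (R[i]) k.+1, is_theta theta,
      is_theta (sigma (R[i]) 1 1 2)
    & is_theta ((2%:R : R[i])^-1 *:
        (sigma (R[i]) 2 2 3 * sigma (R[i]) 2 1 2
         - sigma (R[i]) 2 1 2 * sigma (R[i]) 2 2 3 - 1))].
Proof.
have charF0 : [pchar R[i]] =i pred0 := Num.Theory.pchar_num R[i].
split=> [k k0||].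
- by exists (theta R[i] k); apply: theta_is_theta.
- by rewrite -theta1; apply: theta_is_theta.
by rewrite -theta2 //; apply: theta_is_theta.
Qed.
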